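(* Let $(A,+,\circ)$ be a left brace and let $I,J$ be left nilpotent ideals in $A$. Then $I+J=\{a+b: a\in I,\ b\in J\}$ is a left nilpotent ideal in $A$.
   Context: A left brace is a set $A$ with operations $+,\circ$ such that $(A,+)$ is an abelian group, $(A,\circ)$ is a group, and $a\circ(b+c)+a=a\circ b+a\circ c$ for all $a,b,c\in A$. One writes $a*b=a\circ b-a-b$. An ideal of $A$ is a subgroup $I$ of $(A,+)$ such that $a*i\in I$ and $i*a\in I$ for all $a\in A$, $i\in I$. For subsets $X,Y\subseteq A$, $X*Y$ denotes the set of all finite sums of elements $x*y$ with $x\in X$, $y\in Y$. An ideal $I$ is left nilpotent if $I^{n}=0$ for some $n$, where $I^{1}=I$ and $I^{i+1}=I*I^{i}$. *)

(* Defs.v *)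
From HB Require Import structures.
From mathcomp Require Import all_boot all_algebra.
From mathcomp Require Import classical_sets.

Set Implicit Arguments.
Unset Strict Implicit.
Unset Printing Implicit Defensive.

Import GRing.Theory.
Local Open Scope classical_set_scope.
Local Open Scope ring_scope.

(* A left brace: (A, +) is given by the zmodType structure of A, and (A, o) by
   its (possibly non-commutative) groupType structure, so that a o b is written
   (a * b)%g. *)
HB.mixin Record isLeftBrace A of GRing.Zmodule A & Group A := {
  brace_mulgDr : forall a b c : A,
    (a * (b + c)%R)%g + a = (a * b)%g + (a * c)%g
}.

#[short(type="leftBraceType")]
HB.structure Definition LeftBrace :=
  {A of isLeftBrace A & GRing.Zmodule A & Group A}.

Definition star (A : leftBraceType) (a b : A) : A := (a * b)%g - a - b.

Record is_ideal (A : leftBraceType) (I : set A) : Prop := IsIdeal {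
  ideal0 : I 0;
  idealD : forall x y, I x -> I y -> I (x + y);
  idealN : forall x, I x -> I (- x);
  ideal_starl : forall a i, I i -> I (star a i);
  ideal_starr : forall a i, I i -> I (star i a)
}.

Definition set_star (A : leftBraceType) (X Y : set A) : set A :=
  [set z | exists2 s : seq (A * A),
     forall p, p \in s -> X p.1 /\ Y p.2 & z = \sum_(p <- s) star p.1 p.2].

(* The power I^n, for n >= 1: I^1 = I and I^(i+1) = I * I^i; the value I at
   n = 0 is junk. *)
Definition left_power (A : leftBraceType) (I : set A) (n : nat) : set A :=
  iter n.-1 (set_star I) I.

Definition left_nilpotent (A : leftBraceType) (I : set A) : Prop :=
  exists2 n : nat, (0 < n)%N & left_power I n = [set 0].

Definition set_add (A : leftBraceType) (I J : set A) : set A :=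
  [set a + b | a in I & b in J].

(* Main.v *)
Require Import Defs.
From mathcomp Require Import all_boot all_algebra.
From mathcomp Require Import classical_sets.

(** Write [lambda a x] for a o x - a.  Then [lambda] is an action of the group
    (A, o) on (A, +) by automorphisms and a * x = lambda a x - x, so [star]
    measures how far an element is from acting trivially.  An ideal I absorbs
    I * A, hence it is left nilpotent exactly when I acts unipotently on A,
    that is, when the chain A, I * A, I * (I * A), ... reaches 0
    ([left_nilpotentP]).  The statement thus becomes the fact that two normal
    subgroups acting unipotently generate a subgroup acting unipotently.

    Ideals are normal in (A, o) ([ideal_conj]), and every element of I + J is
    a product i o j ([set_add_mulg]).  By normality every term V of the chain
    of I is stable under the action of all of A ([left_ideal_set_star]).  On the
    quotient V / (I * V) the ideal I acts trivially, so i o j acts there as j does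
    ([star_mulg]); if m applications of J kill A, then m applications of I + J
    send V into I * V ([iter_set_star_add]).  Going down the whole chain of I,
    say of length n, shows that m n applications of I + J kill A. *)

Set Implicit Arguments.
Unset Strict Implicit.
Unset Printing Implicit Defensive.

Import GRing.Theory.
Local Open Scope classical_set_scope.
Local Open Scope ring_scope.

Section LeftBraceTheory.
Variable A : leftBraceType.
Implicit Types (a b c x y i : A) (I J L M V X Y : set A).

(** * The action of (A, o) on (A, +) *)

Definition lambda a x : A := (a * x)%g - a.

Lemma mulg_lambda a x : (a * x)%g = a + lambda a x.
Proof. by rewrite /lambda addrC subrK. Qed.

Lemma starE a x : star a x = lambda a x - x.
Proof. by []. Qed.

Lemma lambda_star a x : lambda a x = x + star a x.
Proof. by rewrite starE addrC subrK. Qed.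

Lemma lambdaD a x y : lambda a (x + y) = lambda a x + lambda a y.
Proof.
apply: (addrI (a + a)).
by rewrite -[RHS]addrACA -!mulg_lambda -brace_mulgDr mulg_lambda addrAC.
Qed.

Lemma lambda0 a : lambda a 0 = 0.
Proof. by apply: (addrI (lambda a 0)); rewrite -lambdaD !addr0. Qed.

Lemma lambdaN a x : lambda a (- x) = - lambda a x.
Proof. by apply: (addrI (lambda a x)); rewrite -lambdaD !subrr lambda0. Qed.

(** The two groups of a brace share their neutral element, because a o 0 = a
    for every a. *)
Lemma brace_1g : 1%g = 0 :> A.
Proof. by rewrite -[RHS]mul1g mulg_lambda lambda0 addr0. Qed.

Lemma lambdaM a b x : lambda (a * b)%g x = lambda a (lambda b x).
Proof.
apply: (addrI (a * b)%g); rewrite -mulg_lambda -mulgA (mulg_lambda b x).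
by rewrite !mulg_lambda lambdaD addrA.
Qed.

Lemma lambda1 x : lambda 1%g x = x.
Proof. by rewrite /lambda mul1g brace_1g subr0. Qed.

Lemma starD a x y : star a (x + y) = star a x + star a y.
Proof. by rewrite !starE lambdaD opprD addrACA. Qed.

Lemma star0 a : star a 0 = 0.
Proof. by rewrite starE lambda0 subr0. Qed.

Lemma starN a x : star a (- x) = - star a x.
Proof. by rewrite !starE lambdaN [RHS]opprD. Qed.

(** This is the expansion of the product of 1 + star a and 1 + star b as
    endomorphisms of (A, +). *)
Lemma star_mulg a b x :
  star (a * b)%g x = star a x + star b x + star a (star b x).
Proof.
rewrite [LHS]starE lambdaM (lambda_star b) lambdaD !(lambda_star a).
by rewrite -(addrA x) [x + _]addrC addrK addrA.
Qed.

(** * Left ideals and products of subsets *)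

(** Left ideals are the additive subgroups stable under [lambda].  The chain
    I * (... (I * A)) consists of left ideals that need not be ideals, so this
    is the class of subsets in which the chain lives. *)
Record is_left_ideal L : Prop := IsLeftIdeal {
  left_ideal0 : L 0;
  left_idealD : forall x y, L x -> L y -> L (x + y);
  left_idealN : forall x, L x -> L (- x);
  left_ideal_star : forall a x, L x -> L (star a x)
}.

Lemma ideal_left_ideal I : is_ideal I -> is_left_ideal I.
Proof. by case=> *; split. Qed.

Lemma left_idealT : is_left_ideal [set: A].
Proof. by split. Qed.

Lemma left_ideal_lambda L a x : is_left_ideal L -> L x -> L (lambda a x).
Proof.
by move=> idL Lx; rewrite lambda_star; apply: left_idealD => //;
   apply: left_ideal_star.
Qed.

Lemma left_ideal_set_add L M :
  is_left_ideal L -> is_left_ideal M -> is_left_ideal (set_add L M).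
Proof.
move=> [L0 LD LN Ls] [M0 MD MN Ms]; split.
- by exists 0 => //; exists 0 => //; rewrite addr0.
- move=> _ _ [x Lx [y My <-]] [z Lz [t Mt <-]].
  by exists (x + z); [exact: LD|exists (y + t); [exact: MD|rewrite addrACA]].
- move=> _ [x Lx [y My <-]].
  by exists (- x); [exact: LN|exists (- y); [exact: MN|rewrite opprD]].
- move=> a _ [x Lx [y My <-]].
  exists (star a x); first exact: Ls.
  by exists (star a y); [exact: Ms|rewrite starD].
Qed.

Lemma set_star_star X Y x y : X x -> Y y -> set_star X Y (star x y).
Proof.
move=> Xx Yy; exists [:: (x, y)]; last by rewrite big_seq1.
by move=> p; rewrite mem_seq1 => /eqP ->.
Qed.

Lemma set_star0 X Y : set_star X Y 0.
Proof. by exists [::]; rewrite ?big_nil. Qed.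

Lemma set_starD X Y x y :
  set_star X Y x -> set_star X Y y -> set_star X Y (x + y).
Proof.
move=> [s sXY ->] [t tXY ->]; exists (s ++ t); last by rewrite big_cat.
by move=> p; rewrite mem_cat => /orP[/sXY|/tXY].
Qed.

(** The induction principle of the additive monoid generated by the products
    x * y. *)
Lemma set_star_ind X Y (P : A -> Prop) :
  P 0 -> (forall x y, P x -> P y -> P (x + y)) ->
  (forall x y, X x -> Y y -> P (star x y)) -> forall z, set_star X Y z -> P z.
Proof.
move=> P0 PD Ps _ [s sXY ->]; rewrite big_seq.
by apply: big_ind => // p /sXY[]; apply: Ps.
Qed.

Lemma set_starS X Y Z : Y `<=` Z -> set_star X Y `<=` set_star X Z.
Proof. by move=> sYZ _ [s sXY ->]; exists s => // p /sXY[Xp /sYZ]. Qed.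

Lemma iter_set_starS n X Y Z :
  Y `<=` Z -> iter n (set_star X) Y `<=` iter n (set_star X) Z.
Proof. by move=> sYZ; elim: n => //= n IHn; apply: set_starS. Qed.

(** * Stability of the chain of an ideal *)

(** Ideals are normal subgroups of (A, o): i o a^-1 lies in the additive coset
    a^-1 + I, and multiplying by a on the left sends this coset to I. *)
Lemma ideal_conj I a i : is_ideal I -> I i -> I (a * i * a^-1)%g.
Proof.
move=> idI Ii; have idlI := ideal_left_ideal idI.
have -> : (a * i * a^-1)%g = lambda a (i + star i a^-1%g).
  rewrite -mulgA (_ : (i * _)%g = a^-1%g + (i + star i a^-1%g)).
    by rewrite mulg_lambda lambdaD addrA -mulg_lambda mulgV brace_1g add0r.
  by rewrite addrCA -lambda_star -mulg_lambda.
by apply: left_ideal_lambda => //; apply: idealD => //; apply: ideal_starr.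
Qed.

(** Conjugation by a turns lambda a (i * v) into i' * lambda a v with i' the
    conjugate of i. *)
Lemma left_ideal_set_star I V :
  is_ideal I -> is_left_ideal V -> is_left_ideal (set_star I V).
Proof.
move=> idI idV; split; [exact: set_star0|exact: set_starD| |].
- apply: (@set_star_ind _ _ (fun x => set_star I V (- x))).
  + by rewrite oppr0; apply: set_star0.
  + by move=> x y ? ?; rewrite opprD; apply: set_starD.
  + move=> i v Ii Vv; rewrite -starN.
    by apply: set_star_star => //; apply: left_idealN.
- move=> a; apply: (@set_star_ind _ _ (fun x => set_star I V (star a x))).
  + by rewrite star0; apply: set_star0.
  + by move=> x y ? ?; rewrite starD; apply: set_starD.
  + move=> i v Ii Vv.
    have -> : star a (star i v)
        = star (a * i * a^-1)%g (lambda a v) + star i (- v).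
      rewrite starE starN; congr (_ - _).
      by rewrite !starE -lambdaM -mulgA mulVg mulg1 lambdaD lambdaN lambdaM.
    apply: set_starD; apply: set_star_star => //.
    * exact: ideal_conj.
    * exact: left_ideal_lambda.
    * exact: left_idealN.
Qed.

Lemma left_ideal_iter_set_star n I V :
  is_ideal I -> is_left_ideal V -> is_left_ideal (iter n (set_star I) V).
Proof. by move=> idI idV; elim: n => //= n; apply: left_ideal_set_star. Qed.

(** The second factor is lambda (i^-1) j, for the element i + j. *)
Lemma set_add_mulg I J x : is_left_ideal J -> set_add I J x ->
  exists i j, [/\ I i, J j & x = (i * j)%g].
Proof.
move=> idJ [i Ii [j Jj <-]]; exists i, (lambda i^-1%g j); split => //.
  exact: left_ideal_lambda.
by rewrite mulg_lambda -lambdaM mulgV lambda1.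
Qed.

Lemma ideal_set_add I J : is_ideal I -> is_ideal J -> is_ideal (set_add I J).
Proof.
move=> idI idJ; have idlI := ideal_left_ideal idI.
have idlJ := ideal_left_ideal idJ.
have [IJ0 IJD IJN IJs] := left_ideal_set_add idlI idlJ.
split=> // a x /(set_add_mulg idlJ)[i [j [Ii Jj ->]]].
rewrite star_mulg addrAC; exists (star i a + star i (star j a)).
  by apply: (idealD idI); apply: ideal_starr.
by exists (star j a) => //; apply: ideal_starr.
Qed.

(** * Left nilpotency as unipotent action *)

(** Since I * A is contained in I, the powers of I and the chain
    I * (... (I * A)) are interleaved. *)
Lemma left_nilpotentP I : is_ideal I ->
  left_nilpotent I <-> exists n, iter n (set_star I) [set: A] `<=` [set 0].
Proof.
move=> idI; split=> [[n n_gt0 In0]|[n An0]].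
  exists n; rewrite -In0 /left_power -(prednK n_gt0) iterSr.
  apply: iter_set_starS; apply: set_star_ind.
  - exact: ideal0.
  - exact: idealD.
  - by move=> i a Ii _; apply: ideal_starr.
exists n.+1 => //; rewrite /left_power /=; apply/seteqP; split.
  by apply: subset_trans An0; apply: iter_set_starS.
move=> _ ->; apply: left_ideal0; apply: left_ideal_iter_set_star => //.
exact: ideal_left_ideal.
Qed.

(** Modulo I * V the ideal I acts trivially on V, so there the chain of I + J
    is contained in that of J. *)
Lemma iter_set_star_add m I J V : is_ideal I -> is_ideal J -> is_left_ideal V ->
  iter m (set_star (set_add I J)) V
    `<=` set_add (set_star I V) (iter m (set_star J) V).
Proof.
move=> idI idJ idV; have idIV := left_ideal_set_star idI idV.
have idJV n : is_left_ideal (iter n (set_star J) V).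
  exact: left_ideal_iter_set_star.
have sJV n : iter n (set_star J) V `<=` V.
  elim: n => //= n IHn; apply: set_star_ind.
  - exact: left_ideal0.
  - exact: left_idealD.
  - by move=> j v _ /IHn; apply: left_ideal_star.
elim: m => [|m IHm] /=.
  by move=> v Vv; exists 0; [exact: set_star0|exists v => //; rewrite add0r].
have [S0 SD _ _] := left_ideal_set_add idIV (idJV m.+1).
apply: set_star_ind => // x y + /IHm[u IVu [w Jw <-]].
move=> /(set_add_mulg (ideal_left_ideal idJ))[i [j [Ii Jj ->]]].
have Vw := sJV m w Jw.
exists (star (i * j)%g u + (star i w + star i (star j w))).
  apply: (left_idealD idIV); first exact: left_ideal_star.
  apply: (left_idealD idIV); apply: set_star_star => //.
  exact: left_ideal_star.
exists (star j w); first exact: set_star_star.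
by rewrite starD (star_mulg i j w) -[LHS]addrA; congr (_ + _); exact: addrAC.
Qed.

Lemma left_nilpotent_set_add I J : is_ideal I -> is_ideal J ->
  left_nilpotent I -> left_nilpotent J -> left_nilpotent (set_add I J).
Proof.
move=> idI idJ /(left_nilpotentP idI)[n AIn0] /(left_nilpotentP idJ)[m AJm0].
apply/(left_nilpotentP (ideal_set_add idI idJ)); exists (n * m)%N.
apply: subset_trans AIn0; elim: n => [//|n IHn].
rewrite mulSn iterD /=.
apply: (subset_trans (iter_set_starS (n := m) IHn)).
apply: (subset_trans (iter_set_star_add idI idJ _)).
  by apply: left_ideal_iter_set_star => //; apply: left_idealT.
move=> _ [u Iu [w Jw <-]].
(* The second summand vanishes, as m applications of J already kill A. *)
have /AJm0 -> : iter m (set_star J) [set: A] w by apply: iter_set_starS Jw.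
by rewrite addr0.
Qed.

End LeftBraceTheory.

Theorem theorem20 (A : leftBraceType) (I J : set A)
    (idI : is_ideal I) (nilI : left_nilpotent I)
    (idJ : is_ideal J) (nilJ : left_nilpotent J) :
  is_ideal (set_add I J) /\ left_nilpotent (set_add I J).
Proof.
by split; [exact: ideal_set_add|exact: left_nilpotent_set_add].
Qed.
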